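(* Let $n\geq 1$ be a natural number. In the endomorphism monoid $\mathcal{E}_n=\mathrm{End}(\mathcal{T}_n)$, the following statements hold: (1) the set of all idempotents is a band, and forms a rank-ordered chain of right-zero semigroups; (2) the set of idempotents of rank $1$ is the minimal ideal of $\mathcal{E}_n$; (3) $\mathscr{H}=\mathscr{L}\subseteq\mathscr{R}=\mathscr{D}=\mathscr{J}$; (4) $\mathscr{R}^*=\widetilde{\mathscr{R}}$ and the classes are the sets of elements with the same rank.
   Context: $\mathcal{T}_n$ is the full transformation semigroup of all maps $\{1,\dots,n\}\to\{1,\dots,n\}$, and $\mathcal{E}_n=\mathrm{End}(\mathcal{T}_n)$ is the monoid of all semigroup endomorphisms of $\mathcal{T}_n$ (not required to fix the identity map) under composition. Maps are written on the right and composed left to right ($\alpha\beta$ means first $\alpha$, then $\beta$). The rank of $\alpha\in\mathcal{E}_n$ is the cardinality of its image. A band is a semigroup consisting of idempotents. A right-zero semigroup is one satisfying $xy=y$. ''Rank-ordered chain of right-zero semigroups'' means: for each rank $k$ the set of idempotents of rank $k$ (if non-empty) is a right-zero semigroup, and the product (in either order) of an idempotent of rank $k$ and an idempotent of rank $l$ is an idempotent of rank $\min(k,l)$. $\mathscr{H},\mathscr{L},\mathscr{R},\mathscr{D},\mathscr{J}$ are Green's relations on $\mathcal{E}_n$: $\alpha\mathrel{\mathscr{L}}\beta$ iff $\mathcal{E}_n\alpha=\mathcal{E}_n\beta$; $\alpha\mathrel{\mathscr{R}}\beta$ iff $\alpha\mathcal{E}_n=\beta\mathcal{E}_n$; $\alpha\mathrel{\mathscr{J}}\beta$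 iff $\mathcal{E}_n\alpha\mathcal{E}_n=\mathcal{E}_n\beta\mathcal{E}_n$; $\mathscr{H}=\mathscr{L}\cap\mathscr{R}$; $\mathscr{D}=\mathscr{L}\vee\mathscr{R}$. Also $\alpha\mathrel{\mathscr{R}^*}\beta$ iff for all $\gamma,\delta\in\mathcal{E}_n$, $\gamma\alpha=\delta\alpha\Leftrightarrow\gamma\beta=\delta\beta$; and $\alpha\mathrel{\widetilde{\mathscr{R}}}\beta$ iff for all idempotents $\eta\in\mathcal{E}_n$, $\eta\alpha=\alpha\Leftrightarrow\eta\beta=\beta$. *)

(* Defs.v *)
From HB Require Import structures.
From mathcomp Require Import all_boot.

Set Implicit Arguments.
Unset Strict Implicit.
Unset Printing Implicit Defensive.

Local Open Scope group_scope.

#[short(type="finMonoidType")]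
HB.structure Definition FinMonoid := {M of Monoid M & Finite M}.

Section FiniteMonoids.

Variable M : finMonoidType.
Implicit Types (a b : M) (A I : {set M}).

Definition idempotents : {set M} := [set e | e * e == e].

Definition subsemigroup A := A != set0 /\ {in A &, forall x y, x * y \in A}.

Definition band A := subsemigroup A /\ {in A, forall x, x * x = x}.

Definition right_zero_semigroup A :=
  subsemigroup A /\ {in A &, forall x y, x * y = y}.

Definition ideal I :=
  I != set0 /\ forall x s, x \in I -> s * x \in I /\ x * s \in I.

Definition minimal_ideal I :=
  ideal I /\ forall I', ideal I' -> I' \subset I -> I' = I.

Definition greenL : rel M :=
  fun a b => [set g * a | g : M] == [set g * b | g : M].

Definition greenR : rel M :=
  fun a b => [set a * g | g : M] == [set b * g | g : M].

Definition greenJ : rel M := fun a b =>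
  [set g * a * h | g : M, h : M] == [set g * b * h | g : M, h : M].

Definition greenH : rel M := fun a b => greenL a b && greenR a b.

(* The join of equivalence relations: [greenL] and [greenR] being symmetric,
   the reflexive transitive closure of their union is an equivalence. *)
Definition greenD : rel M := connect (fun a b => greenL a b || greenR a b).

Definition greenRstar : rel M := fun a b =>
  [forall g : M, forall d : M, (g * a == d * a) == (g * b == d * b)].

Definition greenRtilde : rel M := fun a b =>
  [forall e in idempotents, (e * a == a) == (e * b == b)].

End FiniteMonoids.

Arguments idempotents M : clear implicits.
Arguments greenL M : clear implicits.
Arguments greenR M : clear implicits.
Arguments greenJ M : clear implicits.
Arguments greenH M : clear implicits.
Arguments greenD M : clear implicits.
Arguments greenRstar M : clear implicits.
Arguments greenRtilde M : clear implicits.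

(* An alias, so that the product is composition rather than the pointwise
   product carried by [{ffun _ -> _}]. *)
Definition transf (n : nat) := {ffun 'I_n -> 'I_n}.

Section Transformations.

Variable n : nat.

HB.instance Definition _ := Finite.on (transf n).

(* Maps act on the right: [f * g] is first [f], then [g]. *)
Definition transf_mul (f g : transf n) : transf n := [ffun x => g (f x)].
Definition transf_one : transf n := [ffun x => x].

Fact transf_mulA : associative transf_mul.
Proof. by move=> f g h; apply/ffunP => x; rewrite !ffunE. Qed.
Fact transf_mul1 : left_id transf_one transf_mul.
Proof. by move=> f; apply/ffunP => x; rewrite !ffunE. Qed.
Fact transf_1mul : right_id transf_one transf_mul.
Proof. by move=> f; apply/ffunP => x; rewrite !ffunE. Qed.

HB.instance Definition _ :=
  isMonoid.Build (transf n) transf_mulA transf_mul1 transf_1mul.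

(* Semigroup endomorphisms: no condition on the image of [1]. *)
Record endo := Endo {
  endo_fun :> {ffun transf n -> transf n};
  endoP : [forall x : transf n, forall y : transf n,
             endo_fun (x * y) == endo_fun x * endo_fun y] }.

HB.instance Definition _ := [isSub for endo_fun].
HB.instance Definition _ := [Finite of endo by <:].

Lemma endoM (a : endo) : {morph a : x y / x * y}.
Proof. by move=> x y; have /forallP/(_ x)/forallP/(_ y)/eqP := endoP a. Qed.

Fact endo_mul_subproof (a b : endo) :
  [forall x, forall y,
     [ffun z => b (a z)] (x * y)
       == [ffun z => b (a z)] x * [ffun z => b (a z)] y].
Proof. by apply/forallP=> x; apply/forallP=> y; rewrite !ffunE !endoM. Qed.

Fact endo_one_subproof :
  [forall x, forall y,
     [ffun z : transf n => z] (x * y)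
       == [ffun z : transf n => z] x * [ffun z : transf n => z] y].
Proof. by apply/forallP=> x; apply/forallP=> y; rewrite !ffunE. Qed.

Definition endo_mul (a b : endo) : endo := Endo (endo_mul_subproof a b).
Definition endo_one : endo := Endo endo_one_subproof.

Fact endo_mulA : associative endo_mul.
Proof. by move=> a b c; apply/val_inj/ffunP => x; rewrite !ffunE. Qed.
Fact endo_mul1 : left_id endo_one endo_mul.
Proof. by move=> a; apply/val_inj/ffunP => x; rewrite !ffunE. Qed.
Fact endo_1mul : right_id endo_one endo_mul.
Proof. by move=> a; apply/val_inj/ffunP => x; rewrite !ffunE. Qed.

HB.instance Definition _ := isMonoid.Build endo endo_mulA endo_mul1 endo_1mul.

Definition rank (a : endo) : nat := #|[set a x | x : transf n]|.

Definition idempotents_of_rank (k : nat) : {set endo} :=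
  [set e in idempotents endo | rank e == k].

Definition rank_ordered_chain_of_right_zero_semigroups : Prop :=
  (forall k, idempotents_of_rank k != set0 ->
     right_zero_semigroup (idempotents_of_rank k))
  /\ (forall k l (e f : endo),
        e \in idempotents_of_rank k -> f \in idempotents_of_rank l ->
        e * f \in idempotents_of_rank (minn k l)
        /\ f * e \in idempotents_of_rank (minn k l)).

End Transformations.

(* Main.v *)
Require Import Defs.
From mathcomp Require Import all_boot fingroup perm.

(** The kernels of the endomorphisms of T_n are at most five congruences, and
    they form a chain under inclusion.

    If an endomorphism [a] is not injective, it identifies two constants, hence
    all of them, and then all singular maps ([singular_collapse]): if [m] is the
    least rank of a map [w] that [a] does not send to the common value [e] of the
    constants, then a point where [a w] differs from [e] is sent by the maps
    [a (w * u)] to 'C(n, m) different points, one for each possible image of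
    [w * u], all different from its image under [e]; as 'C(n, m) is at least n
    for 0 < m < n, this forces m = n.

    It remains to understand [a] on the symmetric group.  A point of the image
    of [e] is fixed by all [a p], [p] a permutation, so [a] cannot be injective
    there ([endo_perm_collapse]).  If [a r] = [a 1] for a permutation [r] other
    than 1, then conjugation by [r] identifies transpositions; either two
    transpositions with a common point are identified, and then [a p] depends only on the
    parity of [p], or n = 4 and two disjoint transpositions are identified,
    and then the kernel is that of the action of S_4 = AGL(2, 2) through its
    linear part ([noninjective_morph], [klein_kernel]).  So the kernel of [a]
    is one of the congruences [level k], k <= 4 ([endo_level]): everything
    identified; permutations against singular maps; permutations compared by
    parity; permutations compared by linear part (n = 4 only); equality.

    Since the kernels form a chain, the rank determines the kernel.  Each
    kernel that occurs is the kernel of an idempotent ([idempotent_level]), and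
    e * f = f as soon as the idempotent [e] has a smaller kernel than [f]; the
    statements on idempotents, on R* and on R~ follow from these two facts
    alone.  In a finite monoid, L included in R forces R = D = J
    ([green_eqs]).  Finally L is included in R ([greenL_sub_R]): L-related
    elements have the same image and the same kernel; those whose kernel sees
    at most parity are equal, injective ones are units, and for n = 4 the
    elements with the fourth kernel are translates of each other by inner
    automorphisms, because an action of S_4 on four points with the translations
    as kernel and a fixed point is conjugate to the one by linear parts
    ([conj_linear_part]). *)

Set Implicit Arguments.
Unset Strict Implicit.
Unset Printing Implicit Defensive.

(** * Green's relations in a finite monoid *)

Section FiniteMonoidGreen.

Local Open Scope group_scope.

Variable M : finMonoidType.
Implicit Types a b x y : M.

Lemma greenRP a b :
  reflect ((exists g, a = b * g) /\ (exists g, b = a * g)) (greenR M a b).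
Proof.
apply: (iffP eqP) => [eq_ab | [[g a_bg] [h b_ah]]].
  split.
    have /imsetP[g _ ->]: a \in [set b * g | g : M].
      by rewrite -eq_ab; apply/imsetP; exists 1; rewrite ?mulg1.
    by exists g.
  have /imsetP[g _ ->]: b \in [set a * g | g : M].
    by rewrite eq_ab; apply/imsetP; exists 1; rewrite ?mulg1.
  by exists g.
apply/setP=> z; apply/imsetP/imsetP=> -[k _ ->].
  by exists (g * k); rewrite // mulgA -a_bg.
by exists (h * k); rewrite // mulgA -b_ah.
Qed.

Lemma greenLP a b :
  reflect ((exists g, a = g * b) /\ (exists g, b = g * a)) (greenL M a b).
Proof.
apply: (iffP eqP) => [eq_ab | [[g a_bg] [h b_ah]]].
  split.
    have /imsetP[g _ ->]: a \in [set g * b | g : M].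
      by rewrite -eq_ab; apply/imsetP; exists 1; rewrite ?mul1g.
    by exists g.
  have /imsetP[g _ ->]: b \in [set g * a | g : M].
    by rewrite eq_ab; apply/imsetP; exists 1; rewrite ?mul1g.
  by exists g.
apply/setP=> z; apply/imsetP/imsetP=> -[k _ ->].
  by exists (k * g); rewrite // -mulgA -a_bg.
by exists (k * h); rewrite // -mulgA -b_ah.
Qed.

Lemma greenJP a b :
  reflect ((exists g h, a = g * b * h) /\ (exists g h, b = g * a * h))
          (greenJ M a b).
Proof.
apply: (iffP eqP) => [eq_ab | [[g [h a_gbh]] [g' [h' b_gah]]]].
  split.
    have /imset2P[g h _ _ ->]: a \in [set g * b * h | g : M, h : M].
      by rewrite -eq_ab; apply/imset2P; exists 1 1; rewrite ?mul1g ?mulg1.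
    by exists g, h.
  have /imset2P[g h _ _ ->]: b \in [set g * a * h | g : M, h : M].
    by rewrite eq_ab; apply/imset2P; exists 1 1; rewrite ?mul1g ?mulg1.
  by exists g, h.
apply/setP=> z; apply/imset2P/imset2P=> -[k l _ _ ->].
  by exists (k * g) (h * l); rewrite // a_gbh !mulgA.
by exists (k * g') (h' * l); rewrite // b_gah !mulgA.
Qed.

(** Two of the pairs [(x ^+ i, y ^+ i)] coincide, and
    [b = x ^+ i * b * y ^+ i] for all [i]; this is the stability of finite
    monoids, obtained with the same exponent on both sides. *)
Lemma mul_stable b x y :
  b = x * b * y -> exists p, b = x ^+ p.+1 * b /\ b = b * y ^+ p.+1.
Proof.
move=> b_xby; pose f (i : 'I_#|{: M * M}|.+1) := (x ^+ i, y ^+ i).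
have [/injectiveP/leq_card|/injectivePn[i [j ne_ij eq_ij]]] :=
  boolP (injectiveb f); first by rewrite card_ord ltnn.
have b_iter k : b = x ^+ k * b * y ^+ k.
  elim: k => [|k IHk]; first by rewrite mul1g mulg1.
  have ->: x ^+ k.+1 * b * y ^+ k.+1 = x ^+ k * (x * b * y) * y ^+ k.
    by rewrite expgSr expgS !mulgA.
  by rewrite -b_xby.
wlog lt_ij: i j ne_ij eq_ij / i < j.
  move=> IH; have [lt_ij | lt_ji | /val_inj eq] := ltngtP i j.
  - exact: IH lt_ij.
  - by apply: IH lt_ji; rewrite // eq_sym.
  - by rewrite eq eqxx in ne_ij.
have [eq_x eq_y]: x ^+ j = x ^+ i /\ y ^+ j = y ^+ i by case: eq_ij.
exists (j - i).-1; rewrite prednK ?subn_gt0 //; split.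
  by rewrite [in RHS](b_iter i) !mulgA -expgnDr subnK ?(ltnW lt_ij) // eq_x.
rewrite [in RHS](b_iter i) -mulgA -expgnDr subnKC ?(ltnW lt_ij) // eq_y.
exact: b_iter.
Qed.

(** With [a = g * b * h], stability puts [b * h] in the R-class of [b] and
    in the L-class of [a]. *)
Lemma greenJ_sub_R :
  subrel (greenL M) (greenR M) -> subrel (greenJ M) (greenR M).
Proof.
move=> LR a b /greenJP[[g [h a_gbh]] [g' [h' b_gah]]].
have b_xby: b = (g' * g) * b * (h * h') by rewrite {1}b_gah a_gbh !mulgA.
have [p [b_xp b_yp]] := mul_stable b_xby.
have /LR/eqP L_a: greenL M a (b * h).
  apply/greenLP; split; first by exists g; rewrite a_gbh mulgA.
  exists ((g' * g) ^+ p * g').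
  by rewrite {1}b_xp a_gbh expgSr !mulgA.
have /eqP R_b: greenR M (b * h) b.
  apply/greenRP; split; first by exists h.
  by exists (h' * (h * h') ^+ p); rewrite {1}b_yp expgS !mulgA.
by apply/eqP; rewrite L_a.
Qed.

Lemma green_eqs :
  subrel (greenL M) (greenR M) ->
  [/\ greenH M =2 greenL M, greenR M =2 greenD M & greenD M =2 greenJ M].
Proof.
move=> LR.
have RD: subrel (greenR M) (greenD M).
  by move=> a b ab; apply: connect1; rewrite ab orbT.
have DR: subrel (greenD M) (greenR M).
  move=> a b /connectP[s]; elim: s a => [|c s IHs] a /= => [_ ->|].
    by rewrite /greenR.
  case/andP=> /orP ac /IHs{}IHs /IHs/eqP cb.
  by apply/eqP; rewrite -cb; apply/eqP; case: ac => // /LR.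
have RJ: subrel (greenR M) (greenJ M).
  move=> a b /greenRP[[g a_bg] [h b_ah]].
  by apply/greenJP; split; [exists 1, g | exists 1, h]; rewrite mul1g.
have JR := greenJ_sub_R LR.
have eqb (u v : rel M) : subrel u v -> subrel v u -> u =2 v.
  by move=> uv vu a b; apply/idP/idP; [apply: uv | apply: vu].
split; first by move=> a b; rewrite /greenH; case: (boolP (greenL M a b)) => // /LR.
  exact: eqb.
by apply: eqb => a b => [/DR/RJ | /JR/RD].
Qed.

End FiniteMonoidGreen.

(** * Kernels, ranks and idempotents of endomorphisms *)

Section Kernels.

Local Open Scope group_scope.

Variable n : nat.
Implicit Types (a b c e f : endo n) (x y : transf n).

Definition ker_le a b := forall x y, a x = a y -> b x = b y.

Lemma endo_mulE a b x : (a * b) x = b (a x).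
Proof. exact: ffunE. Qed.

Lemma endo_eqP a b : (forall x, a x = b x) -> a = b.
Proof. by move=> eq_ab; apply/val_inj/ffunP. Qed.

Lemma transf_mulE x y i : (x * y) i = y (x i).
Proof. exact: ffunE. Qed.

Lemma transf_1E i : (1 : transf n) i = i.
Proof. exact: ffunE. Qed.

(** [x] and [e x] are identified by the idempotent [e], hence by [b]. *)
Lemma mul_idem_ker_le e b : e * e = e -> ker_le e b -> e * b = b.
Proof.
move=> ee le_eb; apply: endo_eqP => x.
by rewrite endo_mulE; apply: le_eb; rewrite -endo_mulE ee.
Qed.

Lemma ker_le_mul_fix e b : e * b = b -> ker_le e b.
Proof. by move=> eb x y exy; rewrite -eb !endo_mulE exy. Qed.

Lemma rank_mulr a b : rank (a * b) <= rank b.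
Proof.
apply/subset_leq_card/subsetP=> _ /imsetP[x _ ->].
by rewrite endo_mulE imset_f.
Qed.

Lemma ker_le_factor a b :
  ker_le a b -> exists2 k : transf n -> transf n, (forall x, b x = k (a x))
    & [set b x | x : transf n] = k @: [set a x | x : transf n].
Proof.
move=> le_ab.
pose k y := if [pick x | a x == y] is Some x then b x else y.
have bE x : b x = k (a x).
  by rewrite /k; case: pickP => [z /eqP/le_ab -> // | /(_ x)]; rewrite eqxx.
by exists k => //; rewrite -imset_comp; apply: eq_imset => x /=.
Qed.

Lemma rank_ker_le a b : ker_le a b -> rank b <= rank a.
Proof. by move=> /ker_le_factor[k _ im_b]; rewrite /rank im_b leq_imset_card. Qed.

Lemma rank_mull a b : rank (a * b) <= rank a.
Proof. by apply: rank_ker_le => x y; rewrite !endo_mulE => ->. Qed.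

Lemma rank_eq_ker_le a b : ker_le a b -> rank a = rank b -> ker_le b a.
Proof.
move=> /ker_le_factor[k bE im_b] eq_r x y; rewrite !bE => eq_k.
have /imset_injP k_inj: #|k @: [set a x | x : transf n]|
                          == #|[set a x | x : transf n]|.
  by rewrite -im_b -/(rank a) eq_r.
by apply: k_inj eq_k; apply: imset_f.
Qed.

Lemma rank1P a : reflect (forall x y, a x = a y) (rank a == 1%N).
Proof.
apply: (iffP cards1P) => [[z im_a] x y | a_const].
  have az u : a u = z by apply/set1P; rewrite -im_a imset_f.
  by rewrite !az.
exists (a 1); apply/setP=> z; rewrite inE; apply/imsetP/eqP => [[x _ ->] // | ->].
by exists 1.
Qed.

Lemma exists_endo (f : transf n -> transf n) :
  {morph f : x y / x * y} -> exists a : endo n, forall x, a x = f x.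
Proof.
move=> fM; have fP: [forall x : transf n, forall y : transf n,
    [ffun z : transf n => f z] (x * y) == [ffun z => f z] x * [ffun z => f z] y].
  by apply/forallP=> x; apply/forallP=> y; rewrite !ffunE fM.
by exists (Endo fP) => x; rewrite ffunE.
Qed.

Lemma const_endo_exists : exists a : endo n, rank a = 1%N.
Proof.
have [|a aE] := @exists_endo (fun _ => 1); first by move=> x y; rewrite mulg1.
by exists a; apply/eqP/rank1P=> x y; rewrite !aE.
Qed.

Lemma rank1_mulr a b : rank b = 1%N -> a * b = b.
Proof.
by move=> /eqP/rank1P b_const; apply: endo_eqP => x; rewrite endo_mulE.
Qed.

Lemma rank1_mull a b : rank a = 1%N -> rank (a * b) = 1%N.
Proof.
move=> /eqP/rank1P a_const; apply/eqP/rank1P=> x y.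
by rewrite !endo_mulE (a_const x y).
Qed.

Lemma idem_rankP k e :
  reflect (e * e = e /\ rank e = k) (e \in idempotents_of_rank n k).
Proof.
rewrite !inE; apply: (iffP andP) => -[ee re].
  by split; apply/eqP.
by rewrite ee re.
Qed.

Lemma mem_idem_rank1 e : (e \in idempotents_of_rank n 1) = (rank e == 1%N).
Proof.
apply/idem_rankP/idP => [[_ ->] // | /eqP e1].
by split=> //; apply: rank1_mulr.
Qed.

(** A map of rank one is a right zero of the whole monoid, so every ideal
    contains all of them. *)
Lemma rank1_minimal_ideal :
  minimal_ideal (idempotents_of_rank n 1)
  /\ (forall I : {set endo n}, minimal_ideal I -> I = idempotents_of_rank n 1).
Proof.
have sub_ideal (I : {set endo n}) : ideal I -> idempotents_of_rank n 1 \subset I.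
  case=> /set0Pn[x Ix] idI; apply/subsetP=> e.
  rewrite mem_idem_rank1 => /eqP e1.
  by have [_] := idI x e Ix; rewrite rank1_mulr.
have idE: ideal (idempotents_of_rank n 1).
  split=> [|x s].
    have [e e1] := const_endo_exists.
    by apply/set0Pn; exists e; rewrite mem_idem_rank1 e1.
  rewrite !mem_idem_rank1 => /eqP x1.
  by rewrite rank1_mulr // rank1_mull // x1.
split.
  by split=> // I' idI' sub; apply/eqP; rewrite eqEsubset sub sub_ideal.
by move=> I [idI minI]; apply/esym/minI => //; apply: sub_ideal.
Qed.

Section Chain.

Hypothesis ker_total : forall a b, ker_le a b \/ ker_le b a.

(** In a chain of kernels, the rank alone decides inclusion. *)
Lemma rank_le_ker a b : rank b <= rank a -> ker_le a b.
Proof.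
move=> le_r; have [// | le_ba] := ker_total a b.
by apply: rank_eq_ker_le => //; apply/eqP; rewrite eqn_leq le_r rank_ker_le.
Qed.

(** Everything follows from [e * f = f]: it makes [f * e * f] equal to [f]. *)
Lemma mul_idem_rank_le e f : e * e = e -> f * f = f -> rank f <= rank e ->
  [/\ e * f = f, (f * e) * (f * e) = f * e & rank (f * e) = rank f].
Proof.
move=> ee ff le_r; have ef := mul_idem_ker_le ee (rank_le_ker le_r).
have fef: f * e * f = f by rewrite -mulgA ef.
split=> //; first by rewrite mulgA fef.
by apply/eqP; rewrite eqn_leq rank_mull -{1}fef rank_mull.
Qed.

Lemma idempotents_band : band (idempotents (endo n)).
Proof.
split=> [|e]; last by rewrite inE => /eqP.
split=> [|e f]; first by apply/set0Pn; exists 1; rewrite inE mulg1.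
rewrite !inE => /eqP ee /eqP ff; apply/eqP.
by have [/(mul_idem_rank_le ff ee)[] | /ltnW/(mul_idem_rank_le ee ff)[->]] :=
  leqP (rank e) (rank f).
Qed.

Lemma idempotents_chain : rank_ordered_chain_of_right_zero_semigroups n.
Proof.
split=> [k ne_k | k l e f /idem_rankP[ee rk] /idem_rankP[ff rl]].
  have efk: {in idempotents_of_rank n k &, forall e f, e * f = f}.
    move=> e f /idem_rankP[ee re] /idem_rankP[ff rf].
    by have [] := mul_idem_rank_le ee ff; rewrite ?re ?rf.
  by split=> //; split=> // e f ke kf; rewrite efk.
rewrite -rk -rl; have [le | /ltnW le] := leqP (rank e) (rank f).
  have [fe efe r_ef] := mul_idem_rank_le ff ee le; rewrite fe.
  by split; apply/idem_rankP.
have [ef fef r_fe] := mul_idem_rank_le ee ff le; rewrite ef.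
by split; apply/idem_rankP.
Qed.

Hypothesis idem_ker : forall a, exists e, [/\ e * e = e, ker_le e a & ker_le a e].

Lemma greenRstar_sub_tilde : subrel (greenRstar (endo n)) (greenRtilde (endo n)).
Proof.
move=> a b /forallP Rab; apply/forallP=> e; apply/implyP=> _.
by have /forallP/(_ 1) := Rab e; rewrite !mul1g.
Qed.

(** An idempotent with the kernel of [b] fixes [b] on the left, so it fixes
    [a] as well, which says that the kernel of [b] is included in that of [a]. *)
Lemma greenRtilde_rank a b : greenRtilde (endo n) a b -> rank a = rank b.
Proof.
have tilde_le c d : (forall e, e * e = e -> e * d = d -> e * c = c) ->
  rank c <= rank d.
  move=> Rcd; have [e [ee le_ed le_de]] := idem_ker d; apply: rank_ker_le.
  have ec := Rcd e ee (mul_idem_ker_le ee le_ed).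
  by move=> x y /le_de; apply: ker_le_mul_fix.
move=> /forall_inP Rab.
have fixE e : e * e = e -> (e * a == a) = (e * b == b).
  by move=> ee; have /(_ _)/eqP-> := Rab e; rewrite ?inE ?ee.
apply/eqP; rewrite eqn_leq; apply/andP; split; apply: tilde_le => e ee /eqP.
  by rewrite -fixE // => /eqP.
by rewrite fixE // => /eqP.
Qed.

Lemma rank_greenRstar a b : rank a = rank b -> greenRstar (endo n) a b.
Proof.
move=> eq_r; apply/forallP=> g; apply/forallP=> d.
have eq_of c c' : ker_le c c' -> g * c = d * c -> g * c' = d * c'.
  move=> le_cc eq_c; apply: endo_eqP => x; rewrite !endo_mulE; apply: le_cc.
  by rewrite -!endo_mulE eq_c.
have le_ab: ker_le a b by apply: rank_le_ker; rewrite eq_r.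
have le_ba: ker_le b a by apply: rank_le_ker; rewrite eq_r.
suff ->: (g * a == d * a) = (g * b == d * b) by [].
by apply/idP/idP => /eqP eq_gd; apply/eqP; apply: eq_of eq_gd.
Qed.

Lemma greenRstar_tilde :
  greenRstar (endo n) =2 greenRtilde (endo n)
  /\ (forall a b, greenRstar (endo n) a b = (rank a == rank b)).
Proof.
have RP a b : greenRstar (endo n) a b = (rank a == rank b).
  apply/idP/eqP => [/greenRstar_sub_tilde/greenRtilde_rank //|].
  exact: rank_greenRstar.
split=> // a b; apply/idP/idP; first exact: greenRstar_sub_tilde.
by move/greenRtilde_rank/rank_greenRstar.
Qed.

End Chain.

End Kernels.

(** * Permutations and singular maps *)

Section Transf.

Local Open Scope group_scope.

Variable n : nat.
Implicit Types (a b : endo n) (x y w : transf n) (p q : 'S_n) (i j : 'I_n).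

Definition of_perm p : transf n := pval p.

(** The default value [1] is taken on singular maps. *)
Definition to_perm x : 'S_n := insubd (1 : 'S_n) x.

Definition cst i : transf n := [ffun=> i].

Lemma of_permE p i : of_perm p i = p i.
Proof. by rewrite -pvalE. Qed.

Lemma of_permM p q : of_perm (p * q) = of_perm p * of_perm q.
Proof. by apply/ffunP=> i; rewrite transf_mulE !of_permE permM. Qed.

Lemma of_perm1 : of_perm 1 = 1.
Proof. by apply/ffunP=> i; rewrite of_permE perm1 transf_1E. Qed.

Lemma of_permK : cancel of_perm to_perm.
Proof. exact: valKd. Qed.

Lemma injective_of_perm p : injectiveb (of_perm p).
Proof. exact: (valP p). Qed.

Lemma to_permK x : injectiveb x -> of_perm (to_perm x) = x.
Proof. by move=> x_inj; rewrite /of_perm /to_perm; apply: (insubdK (1 : 'S_n)). Qed.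

Variant transf_spec x : bool -> Prop :=
| TransfPerm p of x = of_perm p : transf_spec x true
| TransfSing of ~~ injectiveb x : transf_spec x false.

Lemma transfP x : transf_spec x (injectiveb x).
Proof.
have [x_inj | x_sing] := boolP (injectiveb x); last exact: TransfSing.
by apply: (@TransfPerm _ (to_perm x)); rewrite to_permK.
Qed.

Lemma injectiveb_mul x y : injectiveb (x * y) = injectiveb x && injectiveb y.
Proof.
apply/idP/andP=> [/injectiveP xy_inj | [/injectiveP x_inj /injectiveP y_inj]].
  have x_inj: injective x.
    by move=> i j eq_ij; apply: xy_inj; rewrite !transf_mulE eq_ij.
  split; apply/injectiveP=> // i j.
  rewrite -[i](f_invF x_inj) -[j](f_invF x_inj) => eq_y.
  by congr (x _); apply: xy_inj; rewrite !transf_mulE.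
by apply/injectiveP=> i j; rewrite !transf_mulE => /y_inj/x_inj.
Qed.

Lemma cst_mul i x : cst i * x = cst (x i).
Proof. by apply/ffunP=> j; rewrite transf_mulE !ffunE. Qed.

Lemma mul_cst x i : x * cst i = cst i.
Proof. by apply/ffunP=> j; rewrite transf_mulE !ffunE. Qed.

Lemma cst_sing i : 1 < n -> ~~ injectiveb (cst i).
Proof.
move=> n_gt1; apply/injectiveP=> inj.
have: injective (fun _ : 'I_n => tt) by move=> j k _; apply: inj; rewrite !ffunE.
by move/leq_card; rewrite card_ord card_unit leqNgt n_gt1.
Qed.

Lemma conj_endo p :
  exists a, forall x, a x = of_perm p^-1 * x * of_perm p.
Proof.
apply: exists_endo => x y /=.
by rewrite !mulgA -(mulgA _ (of_perm p)) -of_permM mulgV of_perm1 mulg1.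
Qed.

(** An idempotent morphism of S_n into itself whose values have a common
    fixed point extends to T_n by sending all singular maps to the constant at
    that point, which is then a zero for the image. *)
Lemma exists_retraction (r : 'S_n -> 'S_n) i : 1 < n ->
    {morph r : p q / p * q} -> (forall p, r (r p) = r p) ->
    (forall p, r p i = i) ->
  exists e : endo n, [/\ e * e = e, forall p, e (of_perm p) = of_perm (r p)
    & forall x, ~~ injectiveb x -> e x = cst i].
Proof.
move=> n_gt1 rM r_idem r_fix.
pose f x := if injectiveb x then of_perm (r (to_perm x)) else cst i.
have fp p : f (of_perm p) = of_perm (r p).
  by rewrite /f injective_of_perm of_permK.
have fs x : ~~ injectiveb x -> f x = cst i by rewrite /f => /negPf->.
have [|e eE] := @exists_endo n f.
  move=> x y; have [p -> | xs] := transfP x; have [q -> | ys] := transfP y.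
  - by rewrite -of_permM !fp -of_permM rM.
  - by rewrite fs ?injectiveb_mul ?(negPf ys) ?andbF // (fs y) // mul_cst.
  - by rewrite fs ?injectiveb_mul ?(negPf xs) // (fs x) // fp cst_mul of_permE r_fix.
  - by rewrite !fs ?injectiveb_mul ?(negPf xs) // mul_cst.
exists e; split=> [|p|x /fs]; rewrite ?eE //.
apply: endo_eqP => x; rewrite endo_mulE !eE.
have [p -> | xs] := transfP x; first by rewrite !fp r_idem.
by rewrite !fs // cst_sing.
Qed.

End Transf.

(** * The affine structure of S_4 *)

Section Fresh.

Lemma exists_fresh n (s : seq 'I_n) : size s < n -> exists i, i \notin s.
Proof.
move=> lt_s; apply/existsP; apply: contraLR lt_s => /existsPn all_s.
rewrite -leqNgt -[X in X <= _]card_ord cardE; apply: uniq_leq_size => [|i _].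
  exact: enum_uniq.
exact: negbNE (all_s i).
Qed.

End Fresh.

Section Klein.

Local Open Scope group_scope.

(** On 'I_4 this is the addition of the vector space of dimension two over
    the field with two elements, points being written in base two. *)
Definition xor n (i j : 'I_n.+1) : 'I_n.+1 := inord (Nat.lxor i j).

Implicit Types (a b c d i j : 'I_4) (p q : 'S_4).

Lemma xorE a b : xor a b = Nat.lxor a b :> nat.
Proof. by case: a b => [[|[|[|[|//]]]] ?] [[|[|[|[|//]]]] ?]; rewrite inordK. Qed.

Lemma xorC : commutative (@xor 3).
Proof.
move=> a b; apply: val_inj; rewrite /= !xorE.
by case: a b => [[|[|[|[|//]]]] ?] [[|[|[|[|//]]]] ?].
Qed.

Lemma xorA : associative (@xor 3).
Proof.
move=> a b c; apply: val_inj; rewrite /= !xorE.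
by case: a b c => [[|[|[|[|//]]]] ?] [[|[|[|[|//]]]] ?] [[|[|[|[|//]]]] ?].
Qed.

Lemma xorxx a : xor a a = ord0.
Proof. by apply: val_inj; rewrite /= xorE; case: a => [[|[|[|[|//]]]] ?]. Qed.

Lemma xorx0 a : xor a ord0 = a.
Proof. by apply: val_inj; rewrite /= xorE; case: a => [[|[|[|[|//]]]] ?]. Qed.

Lemma xor0x a : xor ord0 a = a.
Proof. by rewrite xorC xorx0. Qed.

Lemma xorKx a b : xor (xor b a) a = b.
Proof. by rewrite -xorA xorxx xorx0. Qed.

Lemma xor_inj a : injective (fun b => xor b a).
Proof. exact: (can_inj (g := fun b => xor b a) (fun b => xorKx a b)). Qed.

(** The four vectors of the plane over the field with two elements sum to
    zero. *)
Lemma xor_fourth a b c d : uniq [:: a; b; c; d] -> xor (xor a b) c = d.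
Proof.
move=> uniq_abcd; apply: val_inj; rewrite /= !xorE.
move: uniq_abcd; rewrite -(map_inj_uniq val_inj) /=.
by case: a b c d => [[|[|[|[|//]]]] ?] [[|[|[|[|//]]]] ?] [[|[|[|[|//]]]] ?]
  [[|[|[|[|//]]]] ?].
Qed.

Lemma xor_eq0 a b : (xor a b == ord0) = (a == b).
Proof.
apply/eqP/eqP => [ab0 | ->]; last exact: xorxx.
by rewrite -[a](xorKx b) ab0 xor0x.
Qed.

Lemma fourth_uniq a b c : uniq [:: a; b; c] -> uniq [:: a; b; c; xor (xor a b) c].
Proof.
move=> u3; have [d Nd] := exists_fresh (s := [:: a; b; c]) isT.
have u4: uniq [:: a; b; c; d].
  by rewrite -[[:: a; b; c; d]]/(rcons [:: a; b; c] d) rcons_uniq Nd.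
by rewrite (xor_fourth u4).
Qed.

(** Every permutation of the plane over the field with two elements is
    affine, since it permutes the sets of four distinct points, whose sum is
    zero. *)
Lemma perm_xor3 p a b c : p (xor (xor a b) c) = xor (xor (p a) (p b)) (p c).
Proof.
have [-> | ne_ab] := eqVneq a b; first by rewrite !xorxx !xor0x.
have [-> | ne_ac] := eqVneq a c; first by rewrite (xorC c) (xorC (p c)) !xorKx.
have [-> | ne_bc] := eqVneq b c; first by rewrite !xorKx.
have u4: uniq [:: a; b; c; xor (xor a b) c].
  by apply: fourth_uniq; rewrite /= !inE (negPf ne_ab) (negPf ne_ac) ne_bc.
by apply/esym/xor_fourth; move: u4; rewrite -(map_inj_uniq (@perm_inj _ p)).
Qed.

Lemma perm_xor p a b : p (xor a b) = xor (xor (p a) (p b)) (p ord0).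
Proof. by rewrite -perm_xor3 xorx0. Qed.

Definition translation a : 'S_4 := perm (@xor_inj a).

Lemma translationE a i : translation a i = xor i a.
Proof. exact: permE. Qed.

(** The projection of AGL(2, 2) = S_4 onto GL(2, 2), realised as the
    stabiliser of the origin. *)
Definition linear_part p : 'S_4 := p * translation (p ord0).

Lemma linear_partE p i : linear_part p i = xor (p i) (p ord0).
Proof. by rewrite permM translationE. Qed.

Lemma linear_part_fix0 p : linear_part p ord0 = ord0.
Proof. by rewrite linear_partE xorxx. Qed.

Lemma linear_part_id p : p ord0 = ord0 -> linear_part p = p.
Proof. by move=> p0; apply/permP=> i; rewrite linear_partE p0 xorx0. Qed.

Lemma linear_partM : {morph linear_part : p q / p * q}.
Proof.
move=> p q; apply/permP=> i.
by rewrite permM !linear_partE !permM perm_xor xorKx.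
Qed.

Lemma translation0 : translation ord0 = 1.
Proof. by apply/permP=> i; rewrite translationE xorx0 perm1. Qed.

Lemma mem_four a b c d i : uniq [:: a; b; c; d] -> i \in [:: a; b; c; d].
Proof.
move=> u4; apply/negPn/negP=> Ni.
have: uniq (rcons [:: a; b; c; d] i) by rewrite rcons_uniq Ni.
move/card_uniqP => /= card5.
by have := max_card [in [:: a; b; c; d; i]]; rewrite card5 card_ord.
Qed.

Lemma translation_tperm a b c d : uniq [:: a; b; c; d] ->
  translation (xor a b) = tperm a b * tperm c d.
Proof.
move=> u4; have abc := xor_fourth u4.
apply/permP=> i; rewrite translationE permM.
have := mem_four i u4; move: u4; rewrite /= !inE !negb_or.
case/and4P=> /and3P[ab ac ad] /andP[bc bd] cd _.
case/or4P=> /eqP->.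
- by rewrite xorC (xorC a) xorKx tpermL tpermD // eq_sym.
- by rewrite xorC xorKx tpermR tpermD // eq_sym.
- by rewrite xorC abc (tpermD ac bc) tpermL.
- by rewrite -abc xorC xorA xorxx xor0x abc (tpermD ad bd) tpermR.
Qed.

(** A non-trivial translation is a product of two disjoint transpositions. *)
Lemma odd_translation a : translation a = false :> bool.
Proof.
have [-> | a0] := eqVneq a ord0; first by rewrite translation0 odd_perm1.
have [b Nb] := exists_fresh (s := [:: ord0; a]) isT.
have u4: uniq [:: ord0; a; b; xor (xor ord0 a) b].
  apply: fourth_uniq; move: Nb.
  by rewrite /= !inE !negb_or !(eq_sym ord0) (eq_sym a b) a0 !andbT.
rewrite -[a]xor0x (translation_tperm u4) odd_permM !odd_tperm.
by move: u4; rewrite /= !inE !negb_or => /and4P[/and3P[-> _ _] _ -> _].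
Qed.

Lemma odd_linear_part p : linear_part p = p :> bool.
Proof. by rewrite odd_permM odd_translation addbF. Qed.

End Klein.

(** * The possible kernels and their idempotents *)

Section Levels.

Local Open Scope group_scope.

Variable n : nat.
Implicit Types (a b e : endo n.+1) (x y : transf n.+1) (p q : 'S_n.+1).

Definition parity_class x : option bool :=
  if injectiveb x then Some (to_perm x : bool) else None.

(** On permutations of four points this records the linear part, see
    [linear_part]; the formula is written for all [n] so that all congruences
    live on the same type. *)
Definition linear_class x : option (transf n.+1) :=
  if injectiveb x then Some [ffun i => xor (x i) (x ord0)] else None.

(** The congruences that occur as kernels of endomorphisms, from the
    coarsest to the finest; the fourth one is of interest for four points. *)
Definition level k : rel (transf n.+1) := fun x y =>
  match k with
  | 0 => true
  | 1 => injectiveb x == injectiveb y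
  | 2 => parity_class x == parity_class y
  | 3 => linear_class x == linear_class y
  | _ => x == y
  end.

(** For T_(n+1), the congruences of [level] that are kernels: two different
    classes of maps need a singular map, parity needs a point fixed by a
    transposition, and linear parts need four points. *)
Definition realized k : bool :=
  match k with
  | 0 | 4 => true
  | 1 => 0 < n
  | 2 => 1 < n
  | 3 => n == 3
  | _ => false
  end.

Definition has_level k a := forall x y, (a x == a y) = level k x y.

Lemma parity_class_perm p : parity_class (of_perm p) = Some (p : bool).
Proof. by rewrite /parity_class injective_of_perm of_permK. Qed.

Lemma class_sing x : ~~ injectiveb x ->
  (parity_class x = None) * (linear_class x = None).
Proof. by rewrite /parity_class /linear_class => /negPf->. Qed.

End Levels.

Section LinearClass.

Local Open Scope group_scope.

Lemma linear_class_perm (p : 'S_4) :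
  linear_class (of_perm p) = Some (of_perm (linear_part p)).
Proof.
rewrite /linear_class injective_of_perm; congr Some; apply/ffunP=> i.
by rewrite ffunE !of_permE linear_partE.
Qed.

Lemma linear_class_parity (x y : transf 4) :
  linear_class x = linear_class y -> parity_class x = parity_class y.
Proof.
have [p -> | xs] := transfP x; have [q -> | ys] := transfP y.
- rewrite !linear_class_perm !parity_class_perm => -[/(can_inj (@of_permK _)) eq].
  by rewrite -(odd_linear_part p) eq odd_linear_part.
- by rewrite linear_class_perm (class_sing ys).
- by rewrite linear_class_perm (class_sing xs).
- by rewrite !(class_sing xs, class_sing ys).
Qed.

End LinearClass.

Section LevelChain.

Local Open Scope group_scope.

Variable n : nat.
Implicit Types (a b e : endo n.+1) (x y : transf n.+1) (p q : 'S_n.+1).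

Lemma parity_class_inj x y :
  parity_class x = parity_class y -> injectiveb x = injectiveb y.
Proof. by rewrite /parity_class; do 2?case: ifP. Qed.

Lemma level_le k l x y : k <= l -> realized n l -> level l x y -> level k x y.
Proof.
rewrite leq_eqVlt => /predU1P[-> // | ].
case: k l => [|[|[|[|k]]]] [|[|[|[|[|l]]]]] //= _ rl /eqP eq_xy; apply/eqP;
  rewrite ?eq_xy //.
- exact: parity_class_inj.
- apply: parity_class_inj; case: n rl x y eq_xy => [|[|[|[|//]]]] //= _ x y.
  exact: linear_class_parity.
- by case: n rl x y eq_xy => [|[|[|[|//]]]] //= _ x y; apply: linear_class_parity.
Qed.

Lemma level_ker_le k l a b : has_level k a -> has_level l b ->
  l <= k -> realized n k -> ker_le a b.
Proof.
move=> ka lb le_lk rk x y /eqP; rewrite ka => /(level_le le_lk rk).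
by rewrite -lb => /eqP.
Qed.

(** Between the extreme levels singular maps form a single class without
    permutations, so only permutations have to be compared. *)
Lemma level_split k a y : 0 < k < 4 ->
    (forall x, ~~ injectiveb x -> a x = y) ->
    (forall p, a (of_perm p) != y) ->
    (forall p q, (a (of_perm p) == a (of_perm q))
                 = level k (of_perm p) (of_perm q)) ->
  has_level k a.
Proof.
move=> k_ok a_sing a_sep a_perm x z.
have level_sep p (w : transf n.+1) : ~~ injectiveb w ->
    level k (of_perm p) w = false /\ level k w (of_perm p) = false.
  case: k k_ok {a_perm} => [|[|[|[|//]]]] //= _ ws.
  - by rewrite !injective_of_perm (negPf ws).
  - by rewrite !parity_class_perm !(class_sing ws).
  - by rewrite /linear_class !injective_of_perm (negPf ws).
have [p -> | xs] := transfP x; have [q -> | zs] := transfP z => //.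
- by rewrite (a_sing z) // (negPf (a_sep p)) (level_sep p z zs).1.
- by rewrite (a_sing x) // eq_sym (negPf (a_sep q)) (level_sep q x xs).2.
rewrite !a_sing // eqxx; case: k k_ok {a_perm level_sep} => [|[|[|[|//]]]] //= _.
- by rewrite (negPf xs) (negPf zs).
- by rewrite (class_sing xs) (class_sing zs).
- by rewrite (class_sing xs) (class_sing zs).
Qed.

Lemma retraction_level k (r : 'S_n.+1 -> 'S_n.+1) i : 0 < n -> 0 < k < 4 ->
    {morph r : p q / p * q} -> (forall p, r (r p) = r p) ->
    (forall p, r p i = i) ->
    (forall p q, (r p == r q) = level k (of_perm p) (of_perm q)) ->
  exists e, e * e = e /\ has_level k e.
Proof.
move=> n_gt0 k_ok rM r_idem r_fix level_perm.
have [e [ee eP eS]] := exists_retraction (i := i) n_gt0 rM r_idem r_fix.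
exists e; split=> //; apply: level_split eS _ _ => // [p | p q].
  rewrite eP; apply/eqP=> eq_c.
  by have := cst_sing i (n_gt0 : 1 < n.+1); rewrite -eq_c injective_of_perm.
by rewrite !eP (inj_eq (can_inj (@of_permK _))).
Qed.

Lemma const_level0 a : (forall x y, a x = a y) -> has_level 0 a.
Proof. by move=> a_const x y; rewrite (a_const x y) eqxx. Qed.

End LevelChain.

Section LevelIdempotents.

Local Open Scope group_scope.

(** Retractions realising the levels: a constant; S_n onto the identity; S_n
    onto a transposition, with parity as morphism; S_4 onto its linear group;
    the identity. *)
Lemma idempotent_level n k : realized n k ->
  exists e : endo n.+1, e * e = e /\ has_level k e.
Proof.
case: k => [|[|[|[|[|//]]]]] /= n_ok.
- have [e e1] := const_endo_exists n.+1.
  exists e; split; first exact: rank1_mulr.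
  by apply: const_level0; apply/rank1P; rewrite e1.
- apply: (@retraction_level _ 1 (fun=> 1) ord0) => //.
  + by move=> p q /=; rewrite mulg1.
  + by move=> p; rewrite perm1.
  + by move=> p q; rewrite /= !injective_of_perm !eqxx.
- pose t : 'S_n.+1 := tperm ord0 (inord 1).
  have n_gt0: 0 < n by apply: ltn_trans n_ok.
  have v1: (inord 1 : 'I_n.+1) = 1%N :> nat by rewrite inordK // ltnS.
  have v2: (inord 2 : 'I_n.+1) = 2%N :> nat by rewrite inordK // ltnS.
  have odd_t: t = true :> bool by rewrite odd_tperm -val_eqE /= v1.
  have oddr (p : 'S_n.+1) : (if p then t else 1) = p :> bool.
    by case: (odd_perm p); rewrite ?odd_t ?odd_perm1.
  apply: (@retraction_level _ 2 (fun p : 'S_n.+1 => if p then t else 1)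
            (inord 2)) => //.
  + move=> p q /=; rewrite odd_permM.
    by case: (odd_perm p); case: (odd_perm q); rewrite /= ?mulg1 ?mul1g ?tperm2.
  + by move=> p; rewrite oddr.
  + move=> p; case: ifP => _; last by rewrite perm1.
    by rewrite tpermD // -val_eqE /= ?v1 v2.
  + move=> p q; rewrite /= !parity_class_perm.
    apply/eqP/eqP => [/(congr1 (@odd_perm _)) | [->] //].
    by rewrite !oddr => ->.
- move/eqP: n_ok => ->.
  apply: (@retraction_level _ 3 linear_part ord0) => //.
  + exact: linear_partM.
  + by move=> p; rewrite [LHS]linear_part_id // linear_part_fix0.
  + exact: linear_part_fix0.
  + move=> p q; rewrite /= !linear_class_perm (inj_eq Some_inj).
    by rewrite (inj_eq (can_inj (@of_permK _))).
- by exists 1; split=> [|x y]; rewrite ?mulg1 // !ffunE.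
Qed.

End LevelIdempotents.

(** * Singular maps collapse *)

Section Collapse.

Local Open Scope group_scope.

Lemma leq_bin_inner n m : 0 < m < n -> n <= 'C(n, m).
Proof.
elim: n m => [|n IHn] [|m] //=; rewrite ltnS binS => lt_mn.
move: lt_mn; rewrite leq_eqVlt => /predU1P[<- | lt_mn].
  by rewrite binn binSn.
by rewrite -addn1 leq_add ?bin_gt0 ?IHn // ltnW // ltnW.
Qed.

Variable n : nat.
Implicit Types (a b e : endo n) (x y u v w : transf n) (A B : {set 'I_n}).

Definition im w : {set 'I_n} := [set w i | i : 'I_n].

Lemma im_mul w u : im (w * u) = u @: im w.
Proof.
by rewrite /im -imset_comp; apply: eq_imset => i; rewrite /= transf_mulE.
Qed.

Lemma exists_map_onto A B : #|A| = #|B| -> exists u : transf n, u @: A = B.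
Proof.
move=> eq_AB.
exists [ffun i => nth i (enum B) (index i (enum A))].
have ltA i : i \in A -> index i (enum A) < size (enum B).
  by rewrite -cardE -eq_AB cardE index_mem mem_enum.
apply/eqP; rewrite eqEcard card_in_imset ?eq_AB ?leqnn ?andbT.
  apply/subsetP=> _ /imsetP[i Ai ->].
  by rewrite ffunE -mem_enum mem_nth ?ltA.
move=> i j Ai Aj; rewrite !ffunE (set_nth_default j) ?ltA // => /eqP.
rewrite nth_uniq ?ltA ?enum_uniq // => /eqP eq_ij.
by rewrite -[i](nth_index i (s := enum A)) ?mem_enum // eq_ij nth_index ?mem_enum.
Qed.

(** Keeping the rank means that [u] is injective on the image of [w]. *)
Lemma mul_undo w u : #|im (w * u)| = #|im w| -> exists v, w * u * v = w.
Proof.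
rewrite im_mul => /eqP/imset_injP u_inj.
exists [ffun j => if [pick k in im w | u k == j] is Some k then k else j].
apply/ffunP=> i; rewrite !transf_mulE ffunE.
have wi: w i \in im w by apply: imset_f.
case: pickP => [k /andP[wk /eqP/u_inj-> //] | /(_ (w i))].
by rewrite wi eqxx.
Qed.

Lemma im_small_cst w (i : 'I_n) : #|im w| <= 1 -> exists j, w = cst j.
Proof.
move=> /card_le1_eqP w1; exists (w i).
by apply/ffunP=> k; rewrite ffunE; apply: w1; apply: imset_f.
Qed.

(** Fold a point of [B] outside of [A] onto another point of [B]. *)
Lemma exists_separating A B : 1 < #|A| -> #|A| = #|B| -> A != B ->
  exists t : transf n, #|t @: A| = #|A| /\ #|t @: B| < #|B|.
Proof.
move=> A_gt1 eq_AB ne_AB.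
have /subsetPn[b Bb NAb]: ~~ (B \subset A).
  by apply: contra ne_AB => sBA; rewrite eq_sym eqEcard sBA eq_AB leqnn.
have [c Bc ne_cb]: exists2 c, c \in B & c != b.
  rewrite eq_AB in A_gt1; have /card_gt1P[c [d [Bc Bd ne_cd]]] := A_gt1.
  have [eq_cb | ne_cb] := eqVneq c b; last by exists c.
  by exists d => //; rewrite -eq_cb eq_sym.
pose t : transf n := [ffun i => if i == b then c else i].
have t_id i : i != b -> t i = i by rewrite ffunE => /negPf->.
exists t; split.
  apply: card_in_imset => i j Ai Aj; rewrite !t_id //.
    by apply: contraNneq NAb => <-.
  by apply: contraNneq NAb => <-.
rewrite ltn_neqAle leq_imset_card andbT; apply/imset_injP=> t_inj.
have: c = b by apply: t_inj => //; rewrite t_id // ffunE eqxx.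
by apply/eqP.
Qed.

(** Products with constants turn a pair of identified maps into any pair of
    constants. *)
Lemma noninjective_cst a i j :
  ~~ injectiveb a -> a (cst i) = a (cst j).
Proof.
move=> /injectivePn[x [y ne_xy eq_xy]].
have [k ne_k]: exists k, x k != y k.
  by apply/existsP; apply: contraR ne_xy => /existsPn eq; apply/eqP/ffunP=> k;
    apply/eqP/negPn/eq.
pose z : transf n := [ffun l => if l == x k then i else j].
have ->: cst i = cst k * x * z by rewrite !cst_mul ffunE eqxx.
have ->: cst j = cst k * y * z.
  by rewrite !cst_mul ffunE eq_sym (negPf ne_k).
by rewrite !endoM eq_xy.
Qed.

(** Induction on the rank [m] of [w].  If [a w] differs from the common value
    [e] of the constants at a point [c], then [a (w * u) c] is [e c] exactly
    when [w * u] has rank less than [m].  Sets [A] of size [m] are thus told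
    apart by the points [a (w * u) c] where [w * u] has image [A], because a map
    can collapse one of two sets and not the other; and these points avoid
    [e c].  There are too many sets for that. *)
Lemma singular_collapse a i w :
  ~~ injectiveb a -> ~~ injectiveb w -> a w = a (cst i).
Proof.
move=> a_ninj; set e := a (cst i).
have a_cst j : a (cst j) = e by apply: noninjective_cst.
have eM v : e * a v = e by rewrite -endoM cst_mul a_cst.
have [m] := ubnP #|im w|; elim: m w => // m IHm w; rewrite ltnS => le_wm w_sing.
apply/eqP; apply/negP => /negP ne_we.
have [c ne_c]: exists c, a w c != e c.
  by apply/existsP; apply: contraR ne_we => /existsPn eq; apply/eqP/ffunP=> k;
    apply/eqP/negPn/eq.
have w_gt1: 1 < #|im w|.
  rewrite ltnNge; apply: contra ne_we => /(im_small_cst i)[j ->].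
  by rewrite a_cst.
have w_ltn: #|im w| < n.
  rewrite ltn_neqAle -[X in _ <= X]card_ord max_card andbT.
  apply: contra w_sing => /eqP im_n; apply/injectiveP.
  have /imset_injP w_inj: #|im w| == #|'I_n| by rewrite [X in _ == X]card_ord im_n.
  by move=> j k; apply: w_inj.
have keep u : #|im (w * u)| = #|im w| -> a (w * u) c != e c.
  move=> /mul_undo[v wuv]; apply: contra ne_c => /eqP eq_c.
  by rewrite -wuv endoM transf_mulE eq_c -transf_mulE eM.
have drop u : #|im (w * u)| < #|im w| -> a (w * u) = e.
  move=> lt_u; apply: IHm; first exact: leq_trans le_wm.
  by rewrite injectiveb_mul (negPf w_sing).
pose D := [set A : {set 'I_n} | #|A| == #|im w|].
have uP A : A \in D -> exists u, im (w * u) == A.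
  rewrite inE => /eqP/esym/exists_map_onto[u uA].
  by exists u; rewrite im_mul uA.
pose h A := if [pick u | im (w * u) == A] is Some u then a (w * u) c else c.
have hP A : A \in D -> exists2 u, im (w * u) = A & h A = a (w * u) c.
  move=> /uP[u uA]; rewrite /h; case: pickP => [v /eqP vA | /(_ u)].
    by exists v.
  by rewrite uA.
have h_inj: {in D &, injective h}.
  move=> A B DA DB; have [u uA ->] := hP A DA; have [v vB ->] := hP B DB.
  move: DA DB; rewrite !inE => /eqP cA /eqP cB eq_h.
  apply/eqP; apply/negP => /negP ne_AB.
  have [||t [tA tB]] := exists_separating _ _ ne_AB; rewrite ?cA ?cB //.
  have := keep (u * t); rewrite mulgA im_mul uA tA cA => /(_ erefl).
  rewrite endoM transf_mulE eq_h -transf_mulE -endoM -mulgA drop ?eqxx //.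
  by rewrite mulgA im_mul vB -cB.
have: #|h @: D| <= #|~: [set e c]|.
  apply/subset_leq_card/subsetP=> _ /imsetP[A DA ->]; rewrite !inE.
  have [u uA ->] := hP A DA; apply: keep.
  by rewrite uA; apply/eqP; rewrite inE in DA.
rewrite card_in_imset // card_draws cardsC1 card_ord leqNgt => /negP; apply.
rewrite (@leq_trans n) ?leq_bin_inner ?w_ltn ?(ltnW w_gt1) //.
by rewrite prednK // (leq_ltn_trans _ w_ltn).
Qed.

End Collapse.

(** * Kernels of morphisms from the symmetric group *)

Section SymmetricGroupMorphism.

Local Open Scope group_scope.

Lemma uniq_ord_size n (s : seq 'I_n) : uniq s -> size s <= n.
Proof. by move/card_uniqP <-; rewrite -[X in _ <= X]card_ord max_card. Qed.

Variables (n : nat) (M : monoidType) (phi : 'S_n -> M).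
Hypothesis phiM : {morph phi : p q / p * q}.
Implicit Types (p q r g : 'S_n) (i j k l : 'I_n).

Lemma morph_conj p q g : phi p = phi q -> phi (p ^ g) = phi (q ^ g).
Proof. by move=> eq_pq; rewrite !conjgE !phiM eq_pq. Qed.

Lemma morph_conj_ker p r : phi r = phi 1 -> phi (p ^ r) = phi p.
Proof.
move=> r1; have rV1: phi r^-1 = phi 1.
  by rewrite -[r^-1]mulg1 phiM -r1 -phiM mulVg.
by rewrite conjgE 2!phiM r1 rV1 -2!phiM mulg1 mul1g.
Qed.

Lemma morph_div p q : phi p = phi q -> phi (p * q^-1) = phi 1.
Proof. by move=> eq_pq; rewrite phiM eq_pq -phiM mulgV. Qed.

Definition star_constant :=
  forall i j k, i != j -> i != k -> phi (tperm i j) = phi (tperm i k).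

(** Conjugation by transpositions propagates one coincidence to all. *)
Lemma star_constantP i j k : uniq [:: i; j; k] ->
  phi (tperm i j) = phi (tperm i k) -> star_constant.
Proof.
rewrite /= !inE negb_or andbT => /andP[/andP[ij ik] jk] eq_jk.
have star_i l : i != l -> phi (tperm i l) = phi (tperm i j).
  move=> il; have [-> // | jl] := eqVneq j l.
  have := morph_conj (tperm k l) eq_jk; rewrite !tpermJ tpermL.
  by rewrite !tpermD // eq_sym.
move=> i' j' k' ij' ik'; pose g := tperm i i'.
have ne_g l : i' != l -> i != g l by rewrite -{1}(tpermR i i') (inj_eq perm_inj).
have := morph_conj g (etrans (star_i _ (ne_g _ ij')) (esym (star_i _ (ne_g _ ik')))).
by rewrite !tpermJ tpermL !tpermK.
Qed.

(** All transpositions then have the same image, which squares to the image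
    of the identity. *)
Lemma star_constant_parity p q : star_constant -> p = q :> bool -> phi p = phi q.
Proof.
move=> star eq_odd.
have tperm_eq i j k l : i != j -> k != l -> phi (tperm i j) = phi (tperm k l).
  move=> ij; have [<- ki | il kl] := eqVneq i l.
    by rewrite (tpermC k); apply: star; rewrite // eq_sym.
  by rewrite (star i j l) // tpermC (tpermC k); apply: star; rewrite eq_sym.
have even1 r : r = false :> bool -> phi r = phi 1.
  have [ts -> dts] := prod_tpermP r; rewrite odd_perm_prod //.
  have [m] := ubnP (size ts); elim: m ts dts => // m IHm [|t [|u ts]] //=.
    by rewrite big_nil.
  case/and3P=> dt du dts lt_m; rewrite negbK => ts_even.
  rewrite !big_cons mulgA phiM [in LHS]phiM (tperm_eq _ _ _ _ dt du) -phiM.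
  by rewrite tperm2 -phiM mul1g IHm // ltnW // -ltnS.
rewrite -[p](mulgKV q) phiM even1 -?phiM ?mul1g //.
by rewrite odd_permM odd_permV eq_odd addbb.
Qed.

(** The quotient [r] of [p] and [q] is in the kernel and moves some [x].  For
    any third point [z], conjugation by [r] shows that the transposition of [x]
    and [z] has the same image as that of [r x] and [r z].
    If these transpositions share a point, one coincidence suffices.  If they
    are disjoint and there is a fifth point [v], replacing [r z] by [v] gives a
    coincidence of two transpositions with the common point [r x]. *)
Lemma noninjective_morph p q : p != q -> phi p = phi q ->
  star_constant \/
  n = 4 /\ exists i j k l, uniq [:: i; j; k; l] /\ phi (tperm i j) = phi (tperm k l).
Proof.
move=> ne_pq /morph_div; set r := p * q^-1 => r1.
have [x ne_x]: exists x, r x != x.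
  apply/existsP; apply: contraR ne_pq => /existsPn r_id; apply/eqP.
  apply: (mulIg q^-1); rewrite mulgV -/r; apply/permP=> i; rewrite perm1.
  exact/eqP/negPn/r_id.
have conj_r i j : phi (tperm i j) = phi (tperm (r i) (r j)).
  by rewrite -tpermJ morph_conj_ker.
have [n_gt2 | n_le2] := ltnP 2 n; last first.
  left=> i j k ij ik; have [-> // | jk] := eqVneq j k.
  have: uniq [:: i; j; k] by rewrite /= !inE negb_or ij ik jk.
  by move/uniq_ord_size => /= /leq_trans/(_ n_le2).
have [z] := exists_fresh (s := [:: x; r x]) n_gt2.
rewrite !inE negb_or => /andP[zx zr].
have rxz: r x != r z by rewrite (inj_eq perm_inj) eq_sym.
have eq_xz := conj_r x z.
have [rz_x | rzx] := eqVneq (r z) x.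
  left; apply: (@star_constantP x z (r x)).
    by rewrite /= !inE negb_or (eq_sym x) zx (eq_sym x) ne_x zr.
  by rewrite eq_xz rz_x tpermC.
have [rz_z | rzz] := eqVneq (r z) z.
  left; apply: (@star_constantP z x (r x)).
    by rewrite /= !inE negb_or zx zr eq_sym ne_x.
  by rewrite tpermC eq_xz rz_z tpermC.
have u4: uniq [:: x; z; r x; r z].
  rewrite /= !inE !negb_or (eq_sym x z) (eq_sym x (r x)) (eq_sym x (r z)).
  by rewrite (eq_sym z (r z)) zx ne_x rzx zr rzz rxz.
have [n_le4 | n_gt4] := leqP n 4.
  right; split; last by exists x, z, (r x), (r z).
  by apply/eqP; rewrite eqn_leq n_le4 (uniq_ord_size u4).
left; have [v] := exists_fresh (s := [:: x; z; r x; r z]) n_gt4.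
rewrite !inE !negb_or => /and4P[vx vz vrx vrz].
apply: (@star_constantP (r x) (r z) v).
  by rewrite /= !inE negb_or rxz !(eq_sym _ v) vrx vrz.
rewrite -eq_xz; have := morph_conj (tperm (r z) v) eq_xz.
by rewrite !tpermJ tpermL !tpermD // eq_sym.
Qed.

End SymmetricGroupMorphism.

Section KleinKernel.

Local Open Scope group_scope.

Variables (M : monoidType) (phi : 'S_4 -> M).
Hypothesis phiM : {morph phi : p q / p * q}.
Implicit Types (p q r g : 'S_4) (a i j k l : 'I_4).

Lemma translationJ a g :
  g ord0 = ord0 -> translation a ^ g = translation (g a).
Proof.
move=> g0; apply/permP=> i; rewrite -[i](permKV g) permJ !translationE.
by rewrite perm_xor g0 xorx0.
Qed.

(** The identified pair of disjoint transpositions multiplies to a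
    translation in the kernel, and all translations other than the identity are
    conjugate, so [phi] factors through the linear part.  If it identifies two
    different linear parts, their quotient is in the kernel, fixes the origin
    and moves some [x]; conjugating the transposition of the origin and [x] by
    it produces two identified transpositions with a common point. *)
Lemma klein_kernel i j k l :
    uniq [:: i; j; k; l] -> phi (tperm i j) = phi (tperm k l) ->
  star_constant phi
  \/ forall p q, (phi p == phi q) = (linear_part p == linear_part q).
Proof.
move=> u4 eq_t.
have ij: xor i j != ord0.
  by rewrite xor_eq0; move: u4; rewrite /= !inE !negb_or => /andP[/andP[]].
have tr_ij: phi (translation (xor i j)) = phi 1.
  by rewrite (translation_tperm u4) phiM eq_t -phiM tperm2.
have tr1 a : phi (translation a) = phi 1.
  have [-> | a0] := eqVneq a ord0; first by rewrite translation0.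
  have := morph_conj phiM (tperm (xor i j) a) tr_ij.
  by rewrite conj1g translationJ ?tpermL // tpermD.
have phi_lin r : phi (linear_part r) = phi r by rewrite phiM tr1 -phiM mulg1.
have [/forallP lin_eq | /forallPn[p /forallPn[q]]] :=
    boolP [forall p, forall q,
             (phi p == phi q) ==> (linear_part p == linear_part q)].
  right=> p q; have /forallP/(_ q)/implyP lin_pq := lin_eq p.
  by apply/idP/idP=> // /eqP eq_lin; rewrite -phi_lin eq_lin phi_lin.
rewrite negb_imply => /andP[/eqP eq_pq ne_lin]; left.
pose r := linear_part p * (linear_part q)^-1.
have r1: phi r = phi 1 by apply: morph_div; rewrite // !phi_lin.
have r0: r ord0 = ord0.
  by rewrite permM linear_part_fix0 -{1}(linear_part_fix0 q) permK.
have [x ne_x]: exists x, r x != x.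
  apply/existsP; apply: contraR ne_lin => /existsPn r_id; apply/eqP.
  apply: (mulIg (linear_part q)^-1); rewrite mulgV -/r.
  by apply/permP=> i'; rewrite perm1; apply/eqP/negPn/r_id.
apply: (@star_constantP _ _ _ phiM ord0 x (r x)).
  have x0: x != ord0 by apply: contraNneq ne_x => ->; rewrite r0.
  have: r x != r ord0 by rewrite (inj_eq perm_inj).
  by rewrite r0 /= !inE negb_or !(eq_sym ord0) (eq_sym x (r x)) x0 ne_x => ->.
by rewrite -(morph_conj_ker phiM (tperm ord0 x) r1) tpermJ r0.
Qed.

End KleinKernel.

(** * Classification of the kernels *)

Section Classification.

Local Open Scope group_scope.

(** The images of [phi] permute the image of the idempotent [phi 1]; letting
    them act trivially on the other points gives honest permutations. *)
Lemma perm_representation n (phi : 'S_n -> transf n) :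
    {morph phi : p q / p * q} ->
  exists psi : 'S_n -> 'S_n,
    [/\ {morph psi : p q / p * q},
        forall p i, phi 1 i = i -> psi p i = phi p i,
        forall p i, phi 1 i != i -> psi p i = i
      & forall p q, (psi p == psi q) = (phi p == phi q)].
Proof.
move=> phiM.
have fix_phi p i : phi 1 (phi p i) = phi p i.
  by rewrite -transf_mulE -phiM mulg1.
(* As [phi 1] is idempotent, its image is its set of fixed points. *)
pose f p i := if phi 1 i == i then phi p i else i.
have f_inj p : injective (f p).
  move=> i j; rewrite /f; case: eqP => i1; case: eqP => j1 // eq_ij.
  - by rewrite -i1 -j1 -(mulgV p) phiM !transf_mulE eq_ij.
  - by case: j1; rewrite -eq_ij.
  - by case: i1; rewrite eq_ij.
have psi1 p i : phi 1 i = i -> perm (f_inj p) i = phi p i.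
  by move=> i1; rewrite permE /f i1 eqxx.
have psi2 p i : phi 1 i != i -> perm (f_inj p) i = i.
  by rewrite permE /f => /negPf->.
exists (fun p => perm (f_inj p)); split=> // p q.
  apply/permP=> i; rewrite permM; have [i1 | i1] := eqVneq (phi 1 i) i.
    by rewrite !psi1 // phiM transf_mulE.
  by rewrite !psi2.
apply/eqP/eqP=> eq_pq.
  have phiE r i : phi r i = perm (f_inj r) (phi 1 i).
    by rewrite psi1 // -transf_mulE -phiM mul1g.
  by apply/ffunP=> i; rewrite (phiE p) (phiE q) eq_pq.
apply/permP=> i; have [i1 | i1] := eqVneq (phi 1 i) i.
  by rewrite !psi1 // eq_pq.
by rewrite !psi2.
Qed.

Variable n : nat.
Implicit Types (a : endo n.+1) (x y : transf n.+1) (p q : 'S_n.+1).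

Lemma endo_permM a : {morph (fun p => a (of_perm p)) : p q / p * q}.
Proof. by move=> p q; rewrite of_permM endoM. Qed.

(** If [a] were injective on S_n, the permutations that represent it would be
    all permutations, but they all fix a point of the image of the zero
    [a (cst ord0)]. *)
Lemma endo_perm_collapse a :
  0 < n -> ~~ injectiveb a -> exists p q, p != q /\ a (of_perm p) = a (of_perm q).
Proof.
move=> n_gt0 a_ninj.
have [psi [_ psi1 _ psi_eq]] := perm_representation (endo_permM a).
have [/injectiveP psi_inj | /injectivePn[p [q ne_pq eq_pq]]] :=
  boolP (injectiveb psi).
  2: by exists p, q; split=> //; apply/eqP; rewrite -psi_eq eq_pq.
pose c := a (cst ord0) ord0.
have fix_c p : a (of_perm p) c = c.
  by rewrite -transf_mulE -endoM cst_mul (noninjective_cst _ ord0 a_ninj).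
have [d Nd] := exists_fresh (s := [:: c]) (n_gt0 : 1 < n.+1).
have := f_invF psi_inj (tperm c d); move/(congr1 (fun p : 'S_n.+1 => p c)).
rewrite tpermL psi1 ?fix_c // => eq_cd.
by rewrite -eq_cd inE eqxx in Nd.
Qed.

(** Here [a] on permutations is determined by parity, so the only question is
    whether both parities are identified; that they can be told apart only on
    at least three points is a count in S_2. *)
Lemma star_level a :
    0 < n -> ~~ injectiveb a ->
    (forall p, a (of_perm p) != a (cst ord0)) ->
    star_constant (fun p => a (of_perm p)) ->
  exists k, realized n k /\ has_level k a.
Proof.
move=> n_gt0 a_ninj a_sep star; have phiM := endo_permM a.
have a_sing x : ~~ injectiveb x -> a x = a (cst ord0).
  exact: singular_collapse.
pose t : 'S_n.+1 := tperm ord0 ord_max.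
have odd_t: t by rewrite odd_tperm -val_eqE /= eq_sym -lt0n.
pose s (p : 'S_n.+1) : 'S_n.+1 := if p then t else 1.
have a_par r : a (of_perm r) = a (of_perm (s r)).
  apply: (star_constant_parity phiM) => //; rewrite /s.
  by case: (boolP (odd_perm r)) => _; rewrite ?odd_t ?odd_perm1.
have [eq_t | ne_t] := eqVneq (a (of_perm t)) (a (of_perm 1)).
  exists 1%N; split=> //; apply: level_split a_sing a_sep _ => // r u /=.
  rewrite !injective_of_perm (a_par r) (a_par u) /s eqxx.
  by do 2!case: (odd_perm _); rewrite ?eq_t eqxx.
have a_sep2 r u : (a (of_perm r) == a (of_perm u)) = (odd_perm r == odd_perm u).
  rewrite (a_par r) (a_par u) /s.
  by do 2!case: (odd_perm _); rewrite ?eqxx ?(negPf ne_t) // eq_sym (negPf ne_t).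
exists 2; split; last first.
  apply: level_split a_sing a_sep _ => // r u.
  by rewrite a_sep2 /= !parity_class_perm (inj_eq Some_inj).
have [p [q [ne_pq eq_pq]]] := endo_perm_collapse n_gt0 a_ninj.
have odd_pq: odd_perm p = odd_perm q by apply/eqP; rewrite -a_sep2 eq_pq.
(* On two points or fewer, [p], [q] and [t * p] would be too many. *)
have ne_odd (r u : 'S_n.+1) : odd_perm u = ~~ odd_perm r -> r != u.
  by move=> odd_u; apply/eqP=> eq_ru; move: odd_u; rewrite eq_ru; case: (odd_perm u).
have u3: uniq [:: p; q; t * p].
  by rewrite /= !inE !negb_or ne_pq !ne_odd // odd_permM odd_t // odd_pq.
rewrite /= ltnNge; apply/negP=> n_le1.
have /card_uniqP card3 := u3.
have := max_card [in [:: p; q; t * p]]; rewrite card3 card_Sn.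
have n1: n = 1%N by apply/eqP; rewrite eqn_leq n_le1.
by rewrite /= n1.
Qed.

End Classification.

Lemma endo_level n (a : endo n.+1) : exists k, realized n k /\ has_level k a.
Proof.
have [/injectiveP a_inj | a_ninj] := boolP (injectiveb a).
  by exists 4; split=> // x y; rewrite (inj_eq a_inj).
have n_gt0: 0 < n.
  rewrite lt0n; apply: contraNneq a_ninj => n0; apply/injectiveP=> x y _.
  by apply/ffunP=> i; apply: val_inj; case: (x i) (y i) => [u lt_u] [v lt_v] /=;
    move: lt_u lt_v; rewrite n0 !ltnS !leqn0 => /eqP-> /eqP->.
have a_sing (x : transf n.+1) : ~~ injectiveb x -> a x = a (cst ord0).
  exact: singular_collapse.
have [/existsP[q /eqP aq] | ] := boolP [exists q, a (of_perm q) == a (cst ord0)].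
  exists 0; split=> //; apply: const_level0.
  have a_c (x : transf n.+1) : a x = a (cst ord0).
    have [p -> | /a_sing //] := transfP x.
    by rewrite -[p](mulgKV q)%g of_permM endoM aq -endoM mul_cst.
  by move=> x y; rewrite !a_c.
move=> /existsPn a_sep; have phiM := endo_permM a.
have [p [q [ne_pq eq_pq]]] := endo_perm_collapse n_gt0 a_ninj.
have [star | [n4 [i [j [k [l [u4 eq_t]]]]]]] := noninjective_morph phiM ne_pq eq_pq.
  exact: star_level.
case: n4 => n3; subst n.
have [star | lin_eq] := klein_kernel phiM u4 eq_t; first exact: star_level.
exists 3; split=> //; apply: level_split a_sing a_sep _ => // r u.
rewrite [LHS]lin_eq /= !linear_class_perm (inj_eq Some_inj).
by rewrite (inj_eq (can_inj (@of_permK _))).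
Qed.

Lemma ker_total n (a b : endo n.+1) : ker_le a b \/ ker_le b a.
Proof.
have [k [rk ak]] := endo_level a; have [l [rl bl]] := endo_level b.
have [le_lk | /ltnW le_kl] := leqP l k.
  by left; apply: level_ker_le ak bl _ _.
by right; apply: level_ker_le bl ak _ _.
Qed.

Lemma idempotent_same_kernel n (a : endo n.+1) :
  exists e, [/\ e * e = e, ker_le e a & ker_le a e]%g.
Proof.
have [k [rk ak]] := endo_level a; have [e [ee ek]] := idempotent_level rk.
by exists e; split=> //;
  [apply: level_ker_le ek ak _ _ | apply: level_ker_le ak ek _ _].
Qed.

(** * L is contained in R *)

Section LinearOrbit.

Local Open Scope group_scope.

Lemma perm_morph_eq n (gT : finGroupType) (f g : 'S_n.+1 -> gT) :
    {morph f : p q / p * q} -> {morph g : p q / p * q} ->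
    (forall i, f (tperm ord0 i) = g (tperm ord0 i)) ->
  f =1 g.
Proof.
move=> fM gM eq_fg.
have A_group: group_set [set p | f p == g p].
  apply/group_setP; split=> [|p q]; rewrite !inE.
    by rewrite -(tperm1 ord0) eq_fg.
  by rewrite fM gM => /eqP-> /eqP->.
have: <<[set tperm ord0 i | i in 'I_n.+1]>> \subset Group A_group.
  by rewrite gen_subG; apply/subsetP=> _ /imsetP[i _ ->]; rewrite inE eq_fg.
rewrite gen_tperm => /subsetP sub p; apply/eqP.
by have := sub p (in_setT p); rewrite inE.
Qed.

Implicit Types (p q s : 'S_4) (c d i j k l x y z : 'I_4).

Lemma exists_two_more c d : c != d -> exists k l, uniq [:: c; d; k; l].
Proof.
move=> cd; have [k] := exists_fresh (s := [:: c; d]) isT.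
rewrite !inE negb_or => /andP[kc kd].
exists k, (xor (xor c d) k); apply: fourth_uniq.
by rewrite /= !inE negb_or cd !(eq_sym _ k) kc kd.
Qed.

Lemma perm_two_fixed s c d k l :
  uniq [:: c; d; k; l] -> s c = c -> s d = d -> s != 1 -> s = tperm k l.
Proof.
move=> u4 sc sd s1.
have skl i : i != c -> i != d -> (s i == k) || (s i == l).
  move=> ic id; have := mem_four (s i) u4.
  by rewrite !inE -{1}sc -{1}sd !(inj_eq perm_inj) (negPf ic) (negPf id).
move: (u4); rewrite /= !inE !negb_or => /and4P[/and3P[cd ck cl] /andP[dk dl] kl _].
have := skl k; have := skl l; rewrite !(eq_sym _ c) !(eq_sym _ d).
move=> /(_ cl dl) Hl /(_ ck dk) Hk.
have sk: s k = l.
  case/orP: Hk => /eqP // sk; case/orP: Hl => /eqP sl.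
    by case/negP: kl; rewrite -(inj_eq (@perm_inj _ s)) sk sl.
  case/negP: s1; apply/eqP/permP=> i; rewrite perm1.
  by have := mem_four i u4; rewrite !inE => /or4P[] /eqP->.
have sl: s l = k.
  case/orP: Hl => /eqP // sl; case/negP: kl.
  by rewrite -(inj_eq (@perm_inj _ s)) sk sl.
apply/permP=> i; have := mem_four i u4; rewrite !inE => /or4P[] /eqP->.
- by rewrite sc tpermD // eq_sym.
- by rewrite sd tpermD // eq_sym.
- by rewrite sk tpermL.
- by rewrite sl tpermR.
Qed.

(** If [s] swaps [a] and [s a], the fourth point is fixed. *)
Lemma involution_fixed s c :
  s * s = 1 -> s != 1 -> s c = c -> exists2 d, d != c & s d = d.
Proof.
move=> ss s1 sc; have sK i : s (s i) = i by rewrite -permM ss perm1.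
have [a sa]: exists a, s a != a.
  apply/existsP; apply: contraR s1 => /existsPn s_id; apply/eqP/permP=> i.
  by rewrite perm1; apply/eqP/negPn/s_id.
exists (xor (xor c a) (s a)); last first.
  by rewrite perm_xor3 sc sK -!xorA (xorC a).
have ac: a != c by apply: contraNneq sa => ->; rewrite sc.
have: uniq [:: c; a; s a; xor (xor c a) (s a)].
  apply: fourth_uniq; rewrite /= !inE negb_or (eq_sym c a) ac (eq_sym a) sa.
  by rewrite -{1}sc (inj_eq perm_inj) eq_sym ac.
by rewrite /= !inE !negb_or => /and4P[/and3P[_ _ cd] _ _ _]; rewrite eq_sym.
Qed.

Lemma linear_part_tperm0 x i :
  linear_part (tperm ord0 x) i = xor (tperm ord0 x i) x.
Proof. by rewrite linear_partE tpermL. Qed.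

Lemma linear_part1 : linear_part 1 = 1.
Proof. by rewrite linear_part_id ?perm1. Qed.

Lemma linear_part_tperm_neq1 x : x != ord0 -> linear_part (tperm ord0 x) != 1.
Proof.
move=> x0; have [y] := exists_fresh (s := [:: ord0; x]) isT.
rewrite !inE negb_or => /andP[y0 yx]; apply/eqP=> /permP/(_ y).
rewrite perm1 linear_part_tperm0 tpermD 1?eq_sym // => /(congr1 (xor y)).
by rewrite xorA xorxx xor0x => /eqP; rewrite (negPf x0).
Qed.

(** The transpositions at the origin represent the three transpositions of
    the linear group. *)
Lemma linear_part_tperm_inj x y : x != ord0 -> y != ord0 ->
  linear_part (tperm ord0 x) = linear_part (tperm ord0 y) -> x = y.
Proof.
move=> x0 y0 /permP/(_ x); rewrite !linear_part_tperm0 tpermR xor0x.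
have [// | xy] := eqVneq x y; rewrite tpermD 1?eq_sym //.
move/(congr1 (xor x)); rewrite xorA xorxx xor0x => y_0.
by rewrite -y_0 eqxx in y0.
Qed.

(** Every action of S_4 on four points with a fixed point [c] and the
    translations as kernel is conjugate to the action through the linear part.
    The transposition of the origin and [x] acts as an involution fixing [c] and
    one other point, called [u x]; different [x] give different points, so [u]
    is a permutation, and it conjugates the two actions because a
    non-trivial permutation of four points is determined by two fixed points. *)
Lemma conj_linear_part (psi : 'S_4 -> 'S_4) c :
    {morph psi : p q / p * q} ->
    (forall p q, (psi p == psi q) = (linear_part p == linear_part q)) ->
    (forall p, psi p c = c) ->
  exists2 u : 'S_4, u ord0 = c & forall p, psi p = linear_part p ^ u.
Proof.
move=> psiM psi_eq psi_c.
have psi1: psi 1 = 1 by apply: (mulgI (psi 1)); rewrite -psiM !mulg1.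
pose t x := psi (tperm ord0 x).
have t_neq1 x : x != ord0 -> t x != 1.
  by move=> x0; rewrite -psi1 psi_eq linear_part1 linear_part_tperm_neq1.
pose u x := if x == ord0 then c
            else odflt c [pick d | (d != c) && (t x d == d)].
have uP x : x != ord0 -> u x != c /\ t x (u x) = u x.
  move=> x0; rewrite /u (negPf x0); case: pickP => [d /andP[dc /eqP td] // | no_d].
  have [|d dc td] := involution_fixed _ (t_neq1 x x0) (psi_c _).
    by rewrite -psiM tperm2.
  by have := no_d d; rewrite dc td eqxx.
have u_inj: injective u.
  have u0 x : x != ord0 -> u x = u ord0 -> x = ord0.
    by move=> /uP[ux _]; rewrite {2}/u eqxx => eq_u; rewrite eq_u eqxx in ux.
  move=> x y; have [-> | x0] := eqVneq x ord0.
    by have [-> // | y0] := eqVneq y ord0; move/esym/(u0 y y0) ->.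
  have [-> | y0] := eqVneq y ord0; first exact: u0.
  move=> eq_u; have [[ux tx] [_ ty]] := (uP x x0, uP y y0).
  rewrite eq_sym in ux; have [k [l u4]] := exists_two_more ux.
  apply: linear_part_tperm_inj => //; apply/eqP; rewrite -psi_eq; apply/eqP.
  have -> : psi (tperm ord0 x) = tperm k l.
    exact: perm_two_fixed u4 (psi_c _) tx (t_neq1 x x0).
  rewrite -eq_u in ty.
  exact/esym/(perm_two_fixed u4 (psi_c _) ty (t_neq1 y y0)).
exists (perm u_inj); first by rewrite permE /u eqxx.
apply: perm_morph_eq => // [p q | x]; first by rewrite linear_partM conjMg.
have [-> | x0] := eqVneq x ord0; first by rewrite tperm1 linear_part1 conj1g.
have [y [z u4]]: exists y z, uniq [:: ord0; x; y; z].
  by apply: exists_two_more; rewrite eq_sym.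
have lin_x: linear_part (tperm ord0 x) x = x.
  by rewrite linear_part_tperm0 tpermR xor0x.
rewrite (perm_two_fixed u4 (linear_part_fix0 _) lin_x (linear_part_tperm_neq1 x0)).
rewrite tpermJ !permE; have [_ tx] := uP x x0.
apply: perm_two_fixed (psi_c _) tx (t_neq1 x x0).
by move: u4; rewrite -(map_inj_uniq u_inj) /= {1 2 3}/u eqxx.
Qed.

(** The representation by permutations of [a] is conjugate to the linear one,
    so it fixes only the point [u ord0]; hence [a 1] is the identity, since points
    outside its image would be fixed as well, and singular maps go to the
    constant at that point. *)
Lemma linear_level_conj (a : endo 4) : has_level 3 a ->
  exists u : 'S_4, (forall p, a (of_perm p) = of_perm (linear_part p ^ u))
    /\ forall w : transf 4, ~~ injectiveb w -> a w = cst (u ord0).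
Proof.
move=> a3.
have [psi [psiM psi1 psi2 psi_eq]] := perm_representation (endo_permM a).
have a_ninj: ~~ injectiveb a.
  apply/injectiveP=> a_inj; have := cst_sing (ord0 : 'I_4) isT.
  have := cst_sing (ord_max : 'I_4) isT => s1 s0.
  have /eqP/a_inj/ffunP/(_ ord0): a (cst ord0) == a (cst ord_max).
    by rewrite a3 /= !(class_sing s0) !(class_sing s1).
  by rewrite !ffunE.
set e := a (cst ord0).
have e_fix p i : a (of_perm p) (e i) = e i.
  by rewrite -transf_mulE -endoM cst_mul (noninjective_cst _ ord0 a_ninj).
have [|p|u uc psi_u] := conj_linear_part (c := e ord0) psiM.
- move=> p q; rewrite psi_eq a3 /= !linear_class_perm (inj_eq Some_inj).
  by rewrite (inj_eq (can_inj (@of_permK _))).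
- by rewrite psi1 ?e_fix.
(* Only the origin is fixed by all linear parts. *)
have fixed_u i : (forall p, psi p i = i) -> i = u ord0.
  move=> psi_i; have [| i0] := eqVneq (u^-1 i) ord0.
    by move/(congr1 u); rewrite permKV.
  have [z] := exists_fresh (s := [:: ord0; u^-1 i]) isT.
  rewrite !inE negb_or => /andP[z0 zi].
  have := psi_i (tperm (u^-1 i) z).
  rewrite psi_u linear_part_id ?tpermD // tpermJ permKV tpermL.
  by move=> uz; case/negP: zi; rewrite -uz permK.
have fix_all i : a (of_perm 1) i = i.
  apply/eqP/negPn/negP=> ni; have i_u: i = u ord0.
    by apply: fixed_u => p; apply: psi2.
  by case/negP: ni; rewrite i_u uc e_fix.
exists u; split=> [p | w ws].
  by apply/ffunP=> i; rewrite of_permE -psi_u psi1.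
rewrite (singular_collapse ord0) //; apply/ffunP=> i; rewrite ffunE.
by apply: fixed_u => p; rewrite psi1 ?e_fix.
Qed.

Lemma linear_level_factor (a b : endo 4) :
  has_level 3 a -> has_level 3 b -> exists g, b = a * g.
Proof.
move=> /linear_level_conj[u [aP aS]] /linear_level_conj[v [bP bS]].
have [g gE] := conj_endo (u^-1 * v); exists g.
apply: endo_eqP => w; rewrite endo_mulE gE; have [p -> | ws] := transfP w.
  by rewrite aP bP -!of_permM -mulgA -conjgE -conjgM mulKVg.
by rewrite (aS w) // (bS w) // mul_cst cst_mul of_permE permM permK.
Qed.

End LinearOrbit.

Section GreenL.

Local Open Scope group_scope.

Variable n : nat.
Implicit Types (a b g : endo n.+1) (x y : transf n.+1) (p q : 'S_n.+1).

(** Multiplication by [a] on the left is injective on a finite monoid, hence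
    onto. *)
Lemma injective_factor a b : injective a -> exists g, b = a * g.
Proof.
move=> a_inj; have mul_inj: injective (fun g : endo n.+1 => a * g).
  move=> g h eq_gh; apply: endo_eqP => x.
  by rewrite -[x](f_invF a_inj) -!endo_mulE eq_gh.
by exists (invF mul_inj b); rewrite (f_invF mul_inj).
Qed.

Lemma level_parity k p q :
  k <= 2 -> odd_perm p = odd_perm q -> level k (of_perm p) (of_perm q).
Proof.
case: k => [|[|[|//]]] //= _ eq_odd; first by rewrite !injective_of_perm.
by rewrite !parity_class_perm eq_odd.
Qed.

(** L-related elements have the same image, and this image has one zero, one
    identity and at most one further element. *)
Lemma greenL_parity_eq k a b : k <= 2 -> has_level k a -> has_level k b ->
  ~~ injectiveb a -> ~~ injectiveb b -> greenL (endo n.+1) a b -> a = b.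
Proof.
move=> k_le2 ak bk a_ninj b_ninj /greenLP[[g a_gb] [h b_ha]].
have aE x : a x = b (g x) by rewrite {1}a_gb endo_mulE.
have bE x : b x = a (h x) by rewrite {1}b_ha endo_mulE.
have eq_ker x y : (a x == a y) = (b x == b y) by rewrite ak bk.
(* Each of the two zeros belongs to the image of the other endomorphism. *)
have eq0: a (cst ord0) = b (cst ord0).
  have: b (cst ord0) * a (cst ord0) = a (cst ord0).
    by rewrite bE -endoM mul_cst.
  by rewrite {1}aE -endoM cst_mul (noninjective_cst _ ord0 b_ninj) => <-.
have eq1: a 1 = b 1.
  have: b 1 * a 1 = b 1 by rewrite bE -endoM mulg1.
  by rewrite {1}aE -endoM mul1g -aE.
have b_par p q : odd_perm p = odd_perm q -> b (of_perm p) = b (of_perm q).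
  by move=> eq_odd; apply/eqP; rewrite bk level_parity.
have transfer x y : a y = b y -> a x = a y -> a x = b x.
  by move=> eq_y eq_a; rewrite eq_a eq_y; apply/esym/eqP; rewrite -eq_ker eq_a.
apply: endo_eqP => x; have [p -> | xs] := transfP x; last first.
  by apply: transfer eq0 _; apply: singular_collapse.
have [a_p1 | ne_p1] := eqVneq (a (of_perm p)) (a 1); first exact: transfer a_p1.
have [a_p0 | ne_p0] := eqVneq (a (of_perm p)) (a (cst ord0)).
  exact: transfer a_p0.
have odd_of q : b (of_perm q) != b 1 -> odd_perm q.
  by apply: contraR => /negPf q_even; rewrite -of_perm1 (b_par q 1) // odd_perm1.
have p_odd: odd_perm p by apply: odd_of; rewrite -eq_ker.
rewrite aE in ne_p0 ne_p1 *; move: ne_p0 ne_p1; rewrite eq0 eq1.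
have [q -> _ /odd_of q_odd | gs] := transfP (g (of_perm p)).
  by apply: b_par; rewrite p_odd.
by rewrite (singular_collapse ord0 b_ninj gs) eqxx.
Qed.

End GreenL.

(** L-related elements have the same image, hence the same rank and the same
    kernel. *)
Lemma greenL_sub_R n : subrel (greenL (endo n.+1)) (greenR (endo n.+1)).
Proof.
move=> a b Lab; have [[g a_gb] [h b_ha]] := greenLP _ _ Lab.
have le_ab: ker_le a b.
  by apply: rank_le_ker; [exact: ker_total | rewrite {1}b_ha rank_mulr].
have le_ba: ker_le b a.
  by apply: rank_le_ker; [exact: ker_total | rewrite {1}a_gb rank_mulr].
have eq_ker x y : (a x == a y) = (b x == b y).
  by apply/eqP/eqP; [apply: le_ab | apply: le_ba].
have [/injectiveP a_inj | a_ninj] := boolP (injectiveb a).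
  have b_inj: injective b by move=> x y /le_ba/a_inj.
  by apply/greenRP; split; apply: injective_factor.
have b_ninj: ~~ injectiveb b.
  by apply: contra a_ninj => /injectiveP b_inj; apply/injectiveP=> x y /le_ab/b_inj.
have [k [rk ak]] := endo_level a.
have bk: has_level k b by move=> x y; rewrite -eq_ker ak.
have [k_le2 | k_gt2] := leqP k 2.
  by rewrite (greenL_parity_eq k_le2 ak bk) // /greenR.
case: k k_gt2 rk ak bk => [|[|[|[|[|//]]]]] //= _ rk ak bk; last first.
  by case/injectiveP: a_ninj => x y /eqP; rewrite ak => /eqP.
move/eqP: rk => n3; subst n.
by apply/greenRP; split; apply: linear_level_factor.
Qed.

Theorem proposition7p1 (n : nat) (n_ge1 : 1 <= n) :
  [/\ band (idempotents (endo n))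
      /\ rank_ordered_chain_of_right_zero_semigroups n,
      minimal_ideal (idempotents_of_rank n 1)
      /\ (forall I : {set endo n},
            minimal_ideal I -> I = idempotents_of_rank n 1),
      [/\ greenH (endo n) =2 greenL (endo n),
          subrel (greenL (endo n)) (greenR (endo n)),
          greenR (endo n) =2 greenD (endo n)
        & greenD (endo n) =2 greenJ (endo n)]
    & greenRstar (endo n) =2 greenRtilde (endo n)
      /\ (forall a b : endo n, greenRstar (endo n) a b = (rank a == rank b))].
Proof.
case: n n_ge1 => // n _.
have [HL RD DJ] := green_eqs (@greenL_sub_R n).
have total := @ker_total n; split.
- by split; [apply: idempotents_band | apply: idempotents_chain].
- exact: rank1_minimal_ideal.
- by split=> //; apply: greenL_sub_R.
- by apply: greenRstar_tilde => // a; apply: idempotent_same_kernel.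
Qed.
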